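(* The direct limits of noetherian rings are precisely the directed F-noetherian rings; that is, a ring $R$ is (isomorphic to) a direct limit of a directed system of noetherian rings if and only if $R$ is directed F-noetherian.
   Context: All rings have an identity $1$, subrings contain $1$, and ring morphisms preserve $1$; ''noetherian'' means left and right noetherian. A ring $R$ is directed F-noetherian if to every finite subset $X$ of $R$ one can assign a noetherian subring $R(X)$ of $R$ containing $X$ such that $X\subset Y$ implies $R(X)\subset R(Y)$ for finite subsets $X,Y$ of $R$. *)

(* Defs.v *)
From HB Require Import structures.
From mathcomp Require Import all_boot all_order all_algebra finmap.
From mathcomp Require Import classical_sets.

Set Implicit Arguments.
Unset Strict Implicit.
Unset Printing Implicit Defensive.

Import Order.TTheory GRing.Theory.

Local Open Scope ring_scope.
Local Open Scope classical_set_scope.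

(* [pzRingType] is the type of associative unital rings, zero ring included;
   [{rmorphism A -> B}] preserves 1.  The boolean membership predicates
   ([subringClosed]) and boolean order relations ([preorderType]) used below
   are no restriction in classical logic. *)

Definition left_ideal (R : pzRingType) (I : set R) : Prop :=
  [/\ I 0, forall x y, I x -> I y -> I (x + y)
         & forall a x, I x -> I (a * x)].

Definition right_ideal (R : pzRingType) (I : set R) : Prop :=
  [/\ I 0, forall x y, I x -> I y -> I (x + y)
         & forall a x, I x -> I (x * a)].

Definition ascending_chain_condition (T : Type) (P : set T -> Prop) : Prop :=
  forall I : nat -> set T,
    (forall n, P (I n)) -> (forall n, I n `<=` I n.+1) ->
    exists N, forall n, (N <= n)%N -> I n = I N.

Definition noetherian (R : pzRingType) : Prop :=
  ascending_chain_condition (@left_ideal R) /\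
  ascending_chain_condition (@right_ideal R).

(* The subring of [R] with membership predicate [S], as a ring in its own
   right. *)
Record subring (R : pzRingType) (S : subringClosed R) : Type := Subring {
  subring_val : R;
  subring_valP : subring_val \in S
}.

HB.instance Definition _ (R : pzRingType) (S : subringClosed R) :=
  [isSub for @subring_val R S].
HB.instance Definition _ (R : pzRingType) (S : subringClosed R) :=
  [Choice of subring S by <:].
HB.instance Definition _ (R : pzRingType) (S : subringClosed R) :=
  GRing.SubChoice_isSubPzRing.Build R _ (subring S) (subringClosedP S).

Definition directed_F_noetherian (R : pzRingType) : Prop :=
  exists RX : {fset R} -> subringClosed R,
    [/\ forall X, noetherian (subring (RX X)),
        forall X : {fset R}, {subset X <= RX X}
      & forall X Y : {fset R}, (X `<=` Y)%fset -> {subset RX X <= RX Y}].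

Definition directed (d : Order.disp_t) (I : preorderType d) : Prop :=
  inhabited I /\ forall i j : I, exists k : I, (i <= k)%O /\ (j <= k)%O.

Record ring_system (d : Order.disp_t) (I : preorderType d) := RingSystem {
  sys_ring :> I -> pzRingType;
  sys_map : forall i j : I, (i <= j)%O -> {rmorphism sys_ring i -> sys_ring j};
  sys_map_id : forall (i : I) (le_ii : (i <= i)%O) (x : sys_ring i),
    sys_map le_ii x = x;
  sys_map_comp : forall (i j k : I) (le_ij : (i <= j)%O) (le_jk : (j <= k)%O)
      (le_ik : (i <= k)%O) (x : sys_ring i),
    sys_map le_jk (sys_map le_ij x) = sys_map le_ik x
}.

Arguments sys_map {d I} A {i j} le_ij : rename.

Definition cocone (d : Order.disp_t) (I : preorderType d) (A : ring_system I)
    (S : pzRingType) (f : forall i, {rmorphism A i -> S}) : Prop :=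
  forall (i j : I) (le_ij : (i <= j)%O) (x : A i),
    f j (sys_map A le_ij x) = f i x.

(* Universal property; it determines [R] up to isomorphism and is invariant
   under isomorphism of [R]. *)
Definition is_direct_limit (d : Order.disp_t) (I : preorderType d)
    (A : ring_system I) (R : pzRingType)
    (f : forall i, {rmorphism A i -> R}) : Prop :=
  cocone f /\
  forall (S : pzRingType) (g : forall i, {rmorphism A i -> S}), cocone g ->
    exists u : {rmorphism R -> S},
      (forall i (x : A i), u (f i x) = g i x) /\
      forall v : {rmorphism R -> S},
        (forall i (x : A i), v (f i x) = g i x) -> u =1 v.

Definition direct_limit_of_noetherian (R : pzRingType) : Prop :=
  exists (d : Order.disp_t) (I : preorderType d) (A : ring_system I)
         (f : forall i, {rmorphism A i -> R}),
    [/\ directed I, forall i, noetherian (A i) & is_direct_limit f].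

(* Main.v *)
Require Import Defs.
From mathcomp Require Import all_boot all_order all_algebra finmap.
From HB Require Import structures.
From mathcomp Require Import boolp classical_sets.

Set Implicit Arguments.
Unset Strict Implicit.
Unset Printing Implicit Defensive.

Import GRing.Theory.

Local Open Scope ring_scope.

(** Suppose first that [R] is a direct limit of noetherian rings [A i], with
    canonical maps [f i].  The image of [f i] is a quotient of [A i], hence a
    noetherian subring of [R] ([noetherian_surj]), these images grow with [i],
    and they cover [R] ([direct_limit_cover]).  It remains to choose, for every
    finite subset [X] of [R], an index [i X] whose image contains [X], in such a
    way that [i] is monotone.  A finite set has only finitely many subsets, so
    directedness allows [i X] to be taken above the indices of the smaller
    subsets ([monotone_index]).

    Conversely, if [X |-> R(X)] is a monotone choice of noetherian subrings with
    [X] contained in [R(X)], then the finite subsets of [R], ordered by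
    inclusion, index a directed system of noetherian rings whose transition maps
    are inclusions, and its direct limit is the directed union of the [R(X)],
    which is [R] ([directed_union_direct_limit]). *)

(** * Subrings *)

(** Classically, any set of elements closed under the ring operations is given
    by a boolean membership predicate. *)
Lemma subringClosed_of_set (R : pzRingType) (P : set R) :
    P 1 -> (forall x y, P x -> P y -> P (x - y)) ->
    (forall x y, P x -> P y -> P (x * y)) ->
  exists S : subringClosed R, forall x, x \in S <-> P x.
Proof.
move=> P1 PB PM.
have closedP : GRing.subring_closed (fun x => `[< P x >]).
  split; rewrite /in_mem /=; first exact/asboolP.
    by move=> x y /asboolP Px /asboolP Py; apply/asboolP/PB.
  by move=> x y /asboolP Px /asboolP Py; apply/asboolP/PM.
pose m := GRing.isSubringClosed.Build R _ closedP.
pose S : subringClosed R := HB.pack (fun x => `[< P x >]) m.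
by exists S => x; split=> /asboolP.
Qed.

Definition corestrict (A R : pzRingType) (f : {rmorphism A -> R})
  (S : subringClosed R) (fS : forall a, f a \in S) (a : A) : subring S :=
  Subring (fS a).

Section Corestriction.

Variables (A R : pzRingType) (f : {rmorphism A -> R}) (S : subringClosed R).
Hypothesis fS : forall a, f a \in S.

Lemma corestrict_is_zmod_morphism : zmod_morphism (corestrict fS).
Proof. by move=> x y; apply: val_inj; rewrite [RHS]raddfB /= raddfB. Qed.

Lemma corestrict_is_monoid_morphism : monoid_morphism (corestrict fS).
Proof.
split=> [|x y]; apply: val_inj; first by rewrite [RHS]rmorph1 /= rmorph1.
by rewrite [RHS]rmorphM /= rmorphM.
Qed.

HB.instance Definition _ :=
  GRing.isZmodMorphism.Build A (subring S) (corestrict fS)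
    corestrict_is_zmod_morphism.
HB.instance Definition _ :=
  GRing.isMonoidMorphism.Build A (subring S) (corestrict fS)
    corestrict_is_monoid_morphism.

End Corestriction.

(** * Noetherian quotients *)

(** The chain condition descends along [f] as soon as [f] pulls back members of
    [Q] to members of [P], because a subset of the codomain of a surjection is
    determined by its preimage. *)
Lemma acc_surj (A B : Type) (f : A -> B) (P : set A -> Prop) (Q : set B -> Prop) :
    (forall b, exists a, f a = b) -> (forall J, Q J -> P (f @^-1` J)%classic) ->
  ascending_chain_condition P -> ascending_chain_condition Q.
Proof.
move=> f_surj QP accP J QJ J_incr.
have [||N stab] := accP (fun n => f @^-1` J n)%classic.
- by move=> n; exact/QP/QJ.
- by move=> n a; exact: J_incr.
exists N => n le_Nn; apply/funext => b; have [a <-] := f_surj b.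
exact: (congr1 (fun I : set A => I a) (stab n le_Nn)).
Qed.

Lemma noetherian_surj (A B : pzRingType) (f : {rmorphism A -> B}) :
  (forall b, exists a, f a = b) -> noetherian A -> noetherian B.
Proof.
move=> f_surj [accl accr]; split.
  apply: (acc_surj f_surj _ accl) => J [J0 JD JM].
  split=> [|x y|a x]; rewrite /preimage /= ?rmorph0 ?rmorphD ?rmorphM //.
    exact: JD.
  exact: JM.
apply: (acc_surj f_surj _ accr) => J [J0 JD JM].
split=> [|x y|a x]; rewrite /preimage /= ?rmorph0 ?rmorphD ?rmorphM //.
  exact: JD.
exact: JM.
Qed.

Lemma noetherian_image (A R : pzRingType) (f : {rmorphism A -> R}) :
  noetherian A ->
  exists S : subringClosed R,
    noetherian (subring S) /\ forall x, x \in S <-> exists a, f a = x.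
Proof.
move=> noethA.
have [|||S SP] := @subringClosed_of_set R (fun x => exists a, f a = x).
- by exists 1; rewrite rmorph1.
- by move=> _ _ [a <-] [b <-]; exists (a - b); rewrite rmorphB.
- by move=> _ _ [a <-] [b <-]; exists (a * b); rewrite rmorphM.
exists S; split=> //.
have fS a : f a \in S by apply/SP; exists a.
apply: (@noetherian_surj A _ (corestrict fS)) => // b.
have /SP[a fa] := subring_valP b.
by exists a; apply: val_inj.
Qed.

(** * Monotone choice of indices *)

Section DirectedIndex.

Variables (d : Order.disp_t) (I : preorderType d).
Hypothesis dirI : directed I.

Lemma directed_upper_bound :
  exists ub : seq I -> I, forall s i, i \in s -> (i <= ub s)%O.
Proof.
suff /choice[ub ubP] : forall s : seq I, exists k, forall i, i \in s -> (i <= k)%O.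
  by exists ub.
case: dirI => -[i0] dir; elim=> [|j s [k kP]]; first by exists i0.
have [l [jl kl]] := dir j k.
exists l => i; rewrite inE => /predU1P[-> //|/kP ik].
exact: Order.PreorderTheory.le_trans ik kl.
Qed.

(** Level [n] of the construction bounds level [n.-1] on all subsets; the index
    of [X] is read off at level [#|` X|], so that the proper subsets of [X] have
    been bounded before [X] is reached. *)
Lemma monotone_index (T : choiceType) (c : T -> I) :
  exists i : {fset T} -> I,
    (forall (X : {fset T}) x, x \in X -> (c x <= i X)%O) /\
    (forall X Y : {fset T}, (X `<=` Y)%fset -> (i X <= i Y)%O).
Proof.
have [ub ubP] := directed_upper_bound.
pose F := fix F n (X : {fset T}) : I :=
  if n is n'.+1 then ub [seq F n' Y | Y <- fpowerset X]
  else ub [seq c x | x <- X].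
have F_sub n (X Y : {fset T}) : (X `<=` Y)%fset -> (F n X <= F n.+1 Y)%O.
  by move=> sXY; apply: ubP; apply/mapP; exists X; rewrite ?fpowersetE.
have F_incr m n X : (m <= n)%N -> (F m X <= F n X)%O.
  elim: n => [|n IHn]; first by rewrite leqn0 => /eqP->.
  rewrite leq_eqVlt => /predU1P[-> //|/IHn le_mn].
  exact: Order.PreorderTheory.le_trans le_mn (F_sub n X X (fsubset_refl X)).
exists (fun X => F #|` X| X); split=> [X x xX|X Y].
  have cF : (c x <= F 0%N X)%O by apply: ubP; apply/mapP; exists x.
  exact: Order.PreorderTheory.le_trans cF (F_incr _ _ X (leq0n _)).
rewrite fsubEproper => /predU1P[-> //|XY].
have := fproper_ltn_card XY; case: #|` Y| => // n le_Xn.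
exact: Order.PreorderTheory.le_trans (F_incr _ n X le_Xn)
  (F_sub n X Y (fproper_sub XY)).
Qed.

End DirectedIndex.

(** * Direct limits are covered by the images of their members *)

Lemma direct_limit_image_incr (d : Order.disp_t) (I : preorderType d)
    (A : ring_system I) (R : pzRingType) (f : forall i, {rmorphism A i -> R}) :
    is_direct_limit f -> forall i j, (i <= j)%O ->
  forall x, (exists a, f i a = x) -> exists b, f j b = x.
Proof.
move=> [coc _] i j le_ij _ [a <-].
by exists (sys_map A le_ij a); exact: coc.
Qed.

(** The union [S] of the images is a subring because the system is directed.
    The universal property yields a map from [R] to [S] whose composite with the
    inclusion of [S] is, by uniqueness, the identity of [R]. *)
Lemma direct_limit_cover (d : Order.disp_t) (I : preorderType d)
    (A : ring_system I) (R : pzRingType) (f : forall i, {rmorphism A i -> R}) :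
  directed I -> is_direct_limit f -> forall x, exists i a, f i a = x.
Proof.
move=> [[i0] dir] lim; have [coc univ] := lim.
have common x y : (exists i a, f i a = x) -> (exists i a, f i a = y) ->
    exists k a b, f k a = x /\ f k b = y.
  move=> [i xi] [j yj]; have [k [ik jk]] := dir i j; exists k.
  have [a xa] := direct_limit_image_incr lim ik xi.
  by have [b yb] := direct_limit_image_incr lim jk yj; exists a, b.
have [|||S SP] := @subringClosed_of_set R (fun x => exists i a, f i a = x).
- by exists i0, 1; rewrite rmorph1.
- move=> x y /common/[apply] -[k [a [b [<- <-]]]].
  by exists k, (a - b); rewrite rmorphB.
- move=> x y /common/[apply] -[k [a [b [<- <-]]]].
  by exists k, (a * b); rewrite rmorphM.
have fS i a : f i a \in S by apply/SP; exists i, a.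
pose g i : {rmorphism A i -> subring S} := corestrict (fS i).
have [|u [uf _]] := univ (subring S) g.
  by move=> i j le_ij a; apply: val_inj; exact: coc.
have [w [_ w_uniq]] := univ R f coc.
pose incl : {rmorphism subring S -> R} := val.
have w_id : w =1 idfun by apply: w_uniq.
have w_val : w =1 incl \o u by apply: w_uniq => i a /=; rewrite uf.
by move=> x; apply/SP; rewrite -[x]/(idfun x) -w_id w_val; exact: subring_valP.
Qed.

Lemma direct_limit_directed_F_noetherian (R : pzRingType) :
  direct_limit_of_noetherian R -> directed_F_noetherian R.
Proof.
move=> [d [I [A [f [dirI noethA lim]]]]].
have /choice[c cP] := direct_limit_cover dirI lim.
have /choice[S SP] := fun i => @noetherian_image _ _ (f i) (noethA i).
have [i [ci i_mono]] := monotone_index dirI c.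
exists (fun X => S (i X)); split=> [X|X x xX|X Y sXY x].
- by case: (SP (i X)).
- by apply/(SP _).2; apply: direct_limit_image_incr lim _ _ (ci X x xX) _ (cP x).
- move=> /(SP _).2 xX; apply/(SP _).2.
  exact: direct_limit_image_incr lim _ _ (i_mono X Y sXY) _ xX.
Qed.

(** * Directed unions of subrings are direct limits *)

HB.instance Definition _ (T : choiceType) :=
  Order.Le_isPreorder.Build (Order.Disp tt tt) {fset T}
    (@fsubset_refl T) (@fsubset_trans T).

Lemma fset_directed (T : choiceType) : directed {fset T}.
Proof.
split; first exact: (inhabits fset0).
by move=> X Y; exists (X `|` Y)%fset; split; [exact: fsubsetUl|exact: fsubsetUr].
Qed.

Section DirectedUnion.

Variables (R : pzRingType) (RX : {fset R} -> subringClosed R).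
Hypothesis RX_sub : forall X : {fset R}, {subset X <= RX X}.
Hypothesis RX_mono :
  forall X Y : {fset R}, (X `<=` Y)%fset -> {subset RX X <= RX Y}.

Definition fset_incl (X : {fset R}) : {rmorphism subring (RX X) -> R} := val.

Lemma fset_incl_in (X Y : {fset R}) (le_XY : (X <= Y)%O) (x : subring (RX X)) :
  fset_incl X x \in RX Y.
Proof. exact: RX_mono le_XY _ (subring_valP x). Qed.

Definition fset_system : ring_system {fset R}.
Proof.
refine (@RingSystem _ {fset R} (fun X => subring (RX X))
  (fun X Y le_XY => corestrict (fset_incl_in le_XY)) _ _).
- by move=> X le_XX x; apply: val_inj.
- by move=> X Y Z le_XY le_YZ le_XZ x; apply: val_inj.
Defined.

Lemma directed_union_direct_limit :
  is_direct_limit (fset_incl : forall X, {rmorphism fset_system X -> R}).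
Proof.
split=> [//|S g coc].
pose elt (X : {fset R}) x (xX : x \in X) : fset_system X := Subring (RX_sub xX).
have x1 (x : R) : x \in [fset x]%fset by rewrite inE.
pose u x := g [fset x]%fset (elt _ x (x1 x)).
have ug X (x : fset_system X) : u (fset_incl X x) = g X x.
  set x0 := fset_incl X x; pose Y := (x0 |` X)%fset.
  have sx : ([fset x0]%fset <= Y)%O by exact: fsubsetUl.
  have sX : (X <= Y)%O by exact: fsubsetUr.
  rewrite /u -(coc _ _ sx) -(coc _ _ sX); congr (g Y _); exact: val_inj.
(* Any two elements of [R] lie in a common [R(X)], where [u] is [g X]. *)
have pairP x y : exists X (a b : fset_system X), fset_incl X a = x /\ fset_incl X b = y.
  have xX : x \in [fset x; y]%fset by rewrite !inE eqxx.
  have yX : y \in [fset x; y]%fset by rewrite !inE eqxx orbT.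
  by exists [fset x; y]%fset, (elt _ _ xX), (elt _ _ yX).
have uB : zmod_morphism u.
  move=> x y; have [X [a [b [<- <-]]]] := pairP x y.
  by rewrite -rmorphB !ug rmorphB.
have uM : monoid_morphism u.
  split=> [|x y].
    by rewrite -[1](rmorph1 (fset_incl fset0)) [LHS]ug rmorph1.
  have [X [a [b [<- <-]]]] := pairP x y.
  by rewrite -rmorphM !ug rmorphM.
pose mB := GRing.isZmodMorphism.Build R S u uB.
pose mM := GRing.isMonoidMorphism.Build R S u uM.
pose U : {rmorphism R -> S} := HB.pack u mB mM.
exists U; split=> [X x|v vg x]; first exact: ug.
exact: esym (vg _ (elt _ x (x1 x))).
Qed.

End DirectedUnion.

Theorem proposition8p3 (R : pzRingType) :
  direct_limit_of_noetherian R <-> directed_F_noetherian R.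
Proof.
split; first exact: direct_limit_directed_F_noetherian.
move=> [RX [noethRX RX_sub RX_mono]].
exists _, _, (fset_system RX_mono), (@fset_incl R RX); split=> //.
  exact: fset_directed.
exact: directed_union_direct_limit.
Qed.
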